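(* Let $1 \leq p < \infty$, let $X$ be a non-empty set, let $\omega : X \to [1, \infty)$ be a function, and let $A = (\ell^p(X, \omega), \|\cdot\|_{p\omega}, \cdot)$ with the pointwise product. Then, for every $f \in A$, $$V_A(f) = \mathrm{co}(f(X)).$$ In particular, $V_A(f)$ is convex.
   Context: $\ell^p(X,\omega) = \{f : X \to \mathbb{C} : f\omega \in \ell^p(X)\}$ with norm $\|f\|_{p\omega} = \left(\sum_{x \in X} |f(x)|^p \omega(x)^p\right)^{1/p}$; with the pointwise product it is a commutative Banach algebra. For $K \subseteq \mathbb{C}$, $\mathrm{co}(K) = \{\sum_{i=1}^n \lambda_i z_i : n \in \mathbb{N},\ z_i \in K,\ \lambda_i \geq 0,\ \sum_{i=1}^n \lambda_i = 1\}$ is the convex hull (not closed in general). For a complex normed algebra $(A,\|\cdot\|)$ with dual $A^*$, let $S(A) = \{x \in A : \|x\| = 1\}$, and for $x \in S(A)$ let $D_A(x) = \{\varphi \in A^* : \|\varphi\| = 1 = \varphi(x)\}$. For $a \in A$ and $x \in S(A)$ let $V_A(a;x) = \{\varphi(ax) : \varphi \in D_A(x)\}$. The spatial numerical range of $a$ is $V_A(a) = \bigcup\{V_A(a;x) : x \in S(A)\} \subseteq \mathbb{C}$. *)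

(* Defs.v *)
From HB Require Import structures.
From mathcomp Require Import all_boot all_order all_algebra.
From mathcomp Require Import complex ring.
From mathcomp Require Import all_classical all_reals.
From mathcomp Require Import ereal topology normedtype esum exp convex hoelder.

Set Implicit Arguments.
Unset Strict Implicit.
Unset Printing Implicit Defensive.

Import Order.TTheory GRing.Theory Num.Theory.
Import numFieldNormedType.Exports.
Import ComplexField.Normc.

Local Open Scope classical_set_scope.
Local Open Scope ring_scope.
Local Open Scope complex_scope.

(* Associative normed algebras. No unit is required, so the product is not that
   of a MathComp ring. *)
HB.mixin Record NormedModule_isNormedAlgebra (K : numFieldType) A
    & NormedModule K A := {
  amul : A -> A -> A ;
  amulA : associative amul ;
  amulDl : left_distributive amul +%R ;
  amulDr : right_distributive amul +%R ;
  amulZl : forall (k : K) (a b : A), amul (k *: a) b = k *: amul a b ;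
  amulZr : forall (k : K) (a b : A), amul a (k *: b) = k *: amul a b ;
  ler_norm_amul : forall a b : A, `|amul a b| <= `|a| * `|b|
}.

#[short(type="normedAlgType")]
HB.structure Definition NormedAlgebra (K : numFieldType) :=
  { A of NormedModule_isNormedAlgebra K A & NormedModule K A }.

Section spatial_numerical_range.
Variables (R : realType) (A : normedAlgType R[i]).

(* The real [sup] is the supremum as soon as [phi] is continuous, since the set
   is then bounded. *)
Definition dual_norm (phi : {linear A -> R[i]^o}) : R :=
  sup [set normc (phi a) | a in [set a : A | `|a| <= 1]].

Definition unit_sphere : set A := [set x | `|x| = 1].

Definition support_functionals (x : A) : set {linear A -> R[i]^o} :=
  [set phi : {linear A -> R[i]^o} |
    [/\ continuous phi, dual_norm phi = 1 & phi x = 1]].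

Definition numrange_at (a x : A) : set R[i] :=
  [set z | exists2 phi : {linear A -> R[i]^o},
    support_functionals x phi & phi (amul a x) = z].

Definition numrange (a : A) : set R[i] :=
  \bigcup_(x in unit_sphere) numrange_at a x.

End spatial_numerical_range.

Definition convex_hull (R : realType) (K : set R[i]) : set R[i] :=
  [set z | exists (n : nat) (l : 'I_n -> R) (u : 'I_n -> R[i]),
    [/\ forall i, K (u i), forall i, 0 <= l i, \sum_(i < n) l i = 1
      & z = \sum_(i < n) (l i)%:C * u i]].

Lemma ge0_esumZl (R : realType) (T : choiceType) (c : R) (a : T -> \bar R) :
  0 <= c -> (forall x, 0 <= a x)%E ->
  (\esum_(x in [set: T]) (c%:E * a x) = c%:E * \esum_(x in [set: T]) a x)%E.
Proof.
move=> c0 a0; rewrite /esum -ereal_supZl//.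
  congr ereal_sup; apply/seteqP; split => y /=.
    move=> [A fA <-{y}].
    exists (\sum_(x \in A) a x)%E; first by exists A.
    by rewrite ge0_mule_fsumr.
  by move=> [_ [A fA <-] <-{y}]; exists A => //; rewrite ge0_mule_fsumr.
by apply/set0P; exists (\sum_(x \in set0) a x)%E; exists set0 => //; exact: fsets_set0.
Qed.

Section power_sums.
Variables (R : realType) (X : choiceType) (p : R).
Hypothesis p1 : 1 <= p.
Implicit Types u v : X -> R.

Let E u : \bar R := (\esum_(x in [set: X]) (u x `^ p)%:E)%E.
Let N u : R := fine (E u) `^ p^-1.

Let p_gt0 : 0 < p. Proof. exact: lt_le_trans p1. Qed.
Let p_neq0 : p != 0. Proof. by rewrite gt_eqF. Qed.

Lemma powsum_ge0 u : (0 <= E u)%E.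
Proof. by apply: esum_ge0 => x _; rewrite lee_fin powR_ge0. Qed.

Lemma powsum_le u v : (forall x, 0 <= u x <= v x) -> (E u <= E v)%E.
Proof.
move=> uv; apply: le_esum => x _; have /andP[u0 uvx] := uv x.
by rewrite lee_fin ge0_ler_powR ?nnegrE ?(ltW p_gt0)// (le_trans u0).
Qed.

Lemma powsumZ c u : 0 <= c -> (forall x, 0 <= u x) ->
  (E (fun x => c * u x)%R = (c `^ p)%:E * E u)%E.
Proof.
move=> c0 u0; rewrite /E -ge0_esumZl ?powR_ge0//; last first.
  by move=> x; rewrite lee_fin powR_ge0.
by apply: eq_esum => x _; rewrite powRM.
Qed.

Lemma powsum_conv t u v : 0 <= t <= 1 ->
  (forall x, 0 <= u x) -> (forall x, 0 <= v x) ->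
  (E (fun x => t * u x + (1 - t) * v x)%R <=
     t%:E * E u + (1 - t)%:E * E v)%E.
Proof.
move=> /andP[t0 t1] u0 v0; have t1' : 0 <= 1 - t by rewrite subr_ge0.
have e (w : X -> R) c x : 0 <= c -> (0 <= c%:E * (w x `^ p)%:E)%E.
  by move=> c0; rewrite mule_ge0 ?lee_fin ?powR_ge0.
rewrite /E -!ge0_esumZl//; try by move=> x; rewrite lee_fin powR_ge0.
rewrite -esumD; [|by move=> x _; exact: e..].
apply: le_esum => x _; rewrite -!EFinM -EFinD lee_fin.
have := @convex_powR R p p1 (Itv01 t0 t1) (u x) (v x).
rewrite !inE/= !in_itv/= !u0 !v0 => /(_ erefl erefl).
by rewrite !convRE/=.
Qed.

Lemma powsum_ub u x : ((u x `^ p)%:E <= E u)%E.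
Proof.
apply: ereal_sup_ubound; exists [set x]; last by rewrite fsbig_set1.
by split.
Qed.

Lemma powsum_normE u : (E u < +oo)%E -> E u = (N u `^ p)%:E.
Proof.
move=> Eu; rewrite /N -powRrM mulVf// powRr1 ?fine_ge0 ?powsum_ge0//.
by rewrite fineK// ge0_fin_numE// powsum_ge0.
Qed.

Lemma pownorm_le u c : 0 <= c -> (E u <= (c `^ p)%:E)%E -> N u <= c.
Proof.
move=> c0 Eu; have Eoo : (E u < +oo)%E by rewrite (le_lt_trans Eu) ?ltry.
rewrite -[leRHS](powRr1 c0) -(divff p_neq0) powRrM.
rewrite ge0_ler_powR ?nnegrE ?powR_ge0 ?invr_ge0 ?(ltW p_gt0) ?fine_ge0 ?powsum_ge0//.
by rewrite -lee_fin fineK// ge0_fin_numE// powsum_ge0.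
Qed.

Lemma pownorm_ub u x : (E u < +oo)%E -> 0 <= u x -> u x <= N u.
Proof.
move=> Eu u0; have := powsum_ub u x; rewrite powsum_normE// lee_fin => h.
rewrite leNgt; apply/negP => lt.
by move: h; rewrite leNgt gt0_ltr_powR// nnegrE// powR_ge0.
Qed.

Lemma powsumD_le a b u v : 0 < a -> 0 < b ->
  (forall x, 0 <= u x) -> (forall x, 0 <= v x) ->
  E u = (a `^ p)%:E -> E v = (b `^ p)%:E ->
  (E (fun x => u x + v x)%R <= ((a + b) `^ p)%:E)%E.
Proof.
move=> a0 b0 u0 v0 Eu Ev; have s0 : 0 < a + b by exact: addr_gt0.
have sN0 : a + b != 0 by rewrite gt_eqF.
pose t := a / (a + b).
have t0 : 0 <= t by rewrite divr_ge0// ltW.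
have t1E : 1 - t = b / (a + b).
  by rewrite /t -[1](divff sN0) -mulrBl addrAC subrr add0r.
have t1 : t <= 1 by rewrite -subr_ge0 t1E divr_ge0// ltW.
have unit c w : 0 < c -> (forall x, 0 <= w x) -> E w = (c `^ p)%:E ->
    E (fun x => c^-1 * w x) = 1%E.
  move=> c0 w0 Ew; rewrite powsumZ ?invr_ge0 ?(ltW c0)// Ew.
  by rewrite -EFinM -powRM ?invr_ge0 ?(ltW c0)// mulVf ?gt_eqF// powR1.
have -> : (fun x => u x + v x)%R =
    (fun x => (a + b) * (t * (a^-1 * u x) + (1 - t) * (b^-1 * v x))).
  apply/funext => x; rewrite t1E /t; field.
  by rewrite sN0 !gt_eqF.
have au0 x : 0 <= a^-1 * u x by rewrite mulr_ge0// invr_ge0 ltW.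
have bv0 x : 0 <= b^-1 * v x by rewrite mulr_ge0// invr_ge0 ltW.
rewrite powsumZ ?(ltW s0)//; last first.
  by move=> x; rewrite addr_ge0// mulr_ge0// subr_ge0.
rewrite -[leRHS]mule1 lee_wpmul2l ?lee_fin ?powR_ge0//.
apply: le_trans (@powsum_conv t _ _ _ au0 bv0) _; rewrite ?t0//.
by rewrite !unit// !mule1 -EFinD subrKC.
Qed.

Lemma pow_minkowski u v : (forall x, 0 <= u x) -> (forall x, 0 <= v x) ->
  (E u < +oo)%E -> (E v < +oo)%E ->
  (E (fun x => u x + v x)%R <= ((N u + N v) `^ p)%:E)%E.
Proof.
move=> u0 v0 Eu Ev; have Nu0 : 0 <= N u by exact: powR_ge0.
have Nv0 : 0 <= N v by exact: powR_ge0.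
have [Nu|Nu] := eqVneq (N u) 0.
  rewrite Nu add0r -powsum_normE//; apply: powsum_le => x.
  have : u x <= 0 by rewrite -Nu pownorm_ub.
  by move=> ux0; rewrite addr_ge0//= gerDr.
have [Nv|Nv] := eqVneq (N v) 0.
  rewrite Nv addr0 -powsum_normE//; apply: powsum_le => x.
  have : v x <= 0 by rewrite -Nv pownorm_ub.
  by move=> vx0; rewrite addr_ge0//= gerDl.
have Nu1 : 0 < N u by rewrite lt_neqAle eq_sym Nu Nu0.
have Nv1 : 0 < N v by rewrite lt_neqAle eq_sym Nv Nv0.
exact: (powsumD_le Nu1 Nv1 u0 v0 (powsum_normE Eu) (powsum_normE Ev)).
Qed.

End power_sums.

Section weighted_lp.
Variables (R : realType) (X : choiceType) (p : R) (w : X -> R).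

Definition lpsum (f : X -> R[i]) : \bar R :=
  (\esum_(x in [set: X]) (normc (f x) `^ p * w x `^ p)%:E)%E.

Definition lpnorm (f : X -> R[i]) : R := fine (lpsum f) `^ p^-1.

Definition lpw_pred of 1 <= p & (forall x, 1 <= w x) : {pred X -> R[i]} :=
  fun f => (lpsum f < +oo)%E.

(* The exponent and weight bounds are parameters so that the instances below,
   whose proofs need them, are canonical. *)
Record lpw (p1 : 1 <= p) (w1 : forall x, 1 <= w x) := Lpw {
  lpw_fun :> X -> R[i] ;
  lpw_funP : lpw_fun \in lpw_pred p1 w1
}.

End weighted_lp.

Section lpw_normed_algebra.
Variables (R : realType) (X : choiceType) (p : R) (w : X -> R).
Hypotheses (p1 : 1 <= p) (w1 : forall x, 1 <= w x).
Local Notation C := R[i].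
Local Notation L := (lpw p1 w1).
Local Notation lpsum := (lpsum p w).
Local Notation lpnorm := (lpnorm p w).
Implicit Types f g : X -> C.

Let wn f : X -> R := fun x => normc (f x) * w x.

Let normc_ge0 (z : C) : 0 <= normc z.
Proof. by case: z => a b; exact: sqrtr_ge0. Qed.

Let w_ge0 x : 0 <= w x. Proof. by rewrite (le_trans ler01). Qed.

Let wn_ge0 f x : 0 <= wn f x. Proof. by rewrite mulr_ge0. Qed.

Lemma lpsumE f : lpsum f = (\esum_(x in [set: X]) (wn f x `^ p)%:E)%E.
Proof. by apply: eq_esum => x _; rewrite powRM. Qed.

Let wnD f g x : wn (f + g) x <= wn f x + wn g x.
Proof. by rewrite /wn -mulrDl ler_wpM2r// le_normcD. Qed.

Lemma lpsumD f g : (lpsum f < +oo)%E -> (lpsum g < +oo)%E ->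
  (lpsum (f + g)%R <= ((lpnorm f + lpnorm g) `^ p)%:E)%E.
Proof.
rewrite /Defs.lpnorm !lpsumE => ff gf.
apply: le_trans (pow_minkowski p1 (wn_ge0 f) (wn_ge0 g) ff gf).
by apply: powsum_le => // x; rewrite wn_ge0 wnD.
Qed.

Lemma lpsumZ (a : C) f :
  lpsum (a *: f)%R = ((normc a `^ p)%:E * lpsum f)%E.
Proof.
rewrite !lpsumE -powsumZ//; apply: eq_esum => x _.
by rewrite /wn mulrA -normcM.
Qed.

Lemma lpw_submod_closed : submod_closed (lpw_pred p1 w1).
Proof.
have Z a f : f \in lpw_pred p1 w1 -> a *: f \in lpw_pred p1 w1.
  rewrite !unfold_in lpsumZ => ff; rewrite lte_mul_pinfty ?lee_fin ?powR_ge0//.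
split.
  rewrite unfold_in lpsumE esum1 ?ltry// => x _.
  by rewrite /wn normc0 mul0r powR0// gt_eqF// (lt_le_trans ltr01).
move=> a f g /(Z a); rewrite !unfold_in => ff gf.
exact: le_lt_trans (lpsumD ff gf) (ltry _).
Qed.

HB.instance Definition _ := GRing.isSubmodClosed.Build _ _ (lpw_pred p1 w1)
  lpw_submod_closed.

HB.instance Definition _ := [isSub for @lpw_fun R X p w p1 w1].
HB.instance Definition _ := [Choice of L by <:].
HB.instance Definition _ := [SubChoice_isSubLmodule of L by <:].

Implicit Types F G : L.

Lemma lpw_fin F : (lpsum F < +oo)%E.
Proof. exact: lpw_funP F. Qed.

Lemma lpsum_normE F : lpsum F = (lpnorm F `^ p)%:E.
Proof.
by rewrite /Defs.lpnorm lpsumE -powsum_normE// -lpsumE lpw_fin.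
Qed.

Lemma lpnorm_le F (c : R) : 0 <= c -> (lpsum F <= (c `^ p)%:E)%E ->
  lpnorm F <= c.
Proof. by move=> c0; rewrite /Defs.lpnorm lpsumE; exact: pownorm_le. Qed.

Lemma lpnorm_ub F x : normc (F x) * w x <= lpnorm F.
Proof.
rewrite /Defs.lpnorm lpsumE; apply: (@pownorm_ub _ _ _ p1 (wn F)) => //.
by rewrite -lpsumE lpw_fin.
Qed.

Lemma lpnorm_ge0 F : 0 <= lpnorm F.
Proof. exact: powR_ge0. Qed.

Lemma ler_lpnormD F G : (lpnorm (F + G)%R)%:C <= (lpnorm F)%:C + (lpnorm G)%:C.
Proof.
rewrite -[leRHS](rmorphD (real_complex R) (lpnorm F) (lpnorm G)) lecR.
apply: lpnorm_le; first exact: addr_ge0 (lpnorm_ge0 F) (lpnorm_ge0 G).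
exact: lpsumD (lpw_fin F) (lpw_fin G).
Qed.

Lemma lpnormZ (a : C) F : (lpnorm (a *: F)%R)%:C = `|a| * (lpnorm F)%:C.
Proof.
rewrite -[`|a|]/((normc a)%:C) -rmorphM/=; congr (_%:C).
have p0 : p != 0 by rewrite gt_eqF// (lt_le_trans ltr01).
have c0 : 0 <= normc a * lpnorm F by rewrite mulr_ge0// lpnorm_ge0.
rewrite [LHS](_ : _ = fine (lpsum (a *: (F : X -> C))) `^ p^-1)//.
by rewrite lpsumZ lpsum_normE/= -powRM ?lpnorm_ge0// -powRrM divff// powRr1.
Qed.

Lemma lpnorm_eq0 F : (lpnorm F)%:C = 0 -> F = 0.
Proof.
case=> F0; apply/val_inj/funext => x /=; apply: eq0_normc.
have := lpnorm_ub F x; rewrite F0 => h; apply/eqP.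
have wx : 0 < w x by rewrite (lt_le_trans ltr01).
by rewrite eq_le normc_ge0 andbT -(pmulr_lle0 _ wx).
Qed.

HB.instance Definition _ := Lmodule_isNormed.Build C L
  ler_lpnormD lpnormZ lpnorm_eq0.

Let wnM F G x : wn (fun x => F x * G x) x <= lpnorm F * wn G x.
Proof.
rewrite /wn normcM -mulrA; apply: ler_wpM2r; first exact: wn_ge0.
by apply: le_trans (lpnorm_ub F x); rewrite ler_peMr.
Qed.

Lemma lpsumM F G :
  (lpsum (fun x => F x * G x)%R <= ((lpnorm F * lpnorm G) `^ p)%:E)%E.
Proof.
rewrite (powRM _ (lpnorm_ge0 F) (lpnorm_ge0 G)).
rewrite EFinM -[X in (_ <= _ * X)%E](lpsum_normE G) !lpsumE.
rewrite -(powsumZ p (lpnorm_ge0 F) (wn_ge0 G)).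
by apply: powsum_le => // x; apply/andP; split; [exact: wn_ge0|exact: wnM].
Qed.

Lemma lpw_mulP F G : (fun x => F x * G x) \in lpw_pred p1 w1.
Proof. exact: le_lt_trans (lpsumM F G) (ltry _). Qed.

Definition lpw_mul F G : L := Lpw (lpw_mulP F G).

Lemma lpw_mulA : associative lpw_mul.
Proof. by move=> F G H; apply/val_inj/funext => x /=; rewrite mulrA. Qed.

Lemma lpw_mulDl : left_distributive lpw_mul +%R.
Proof. by move=> F G H; apply/val_inj/funext => x /=; rewrite mulrDl. Qed.

Lemma lpw_mulDr : right_distributive lpw_mul +%R.
Proof. by move=> F G H; apply/val_inj/funext => x /=; rewrite mulrDr. Qed.

Lemma lpw_mulZl (a : C) F G : lpw_mul (a *: F) G = a *: lpw_mul F G.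
Proof. by apply/val_inj/funext => x /=; exact/esym/mulrA. Qed.

Lemma lpw_mulZr (a : C) F G : lpw_mul F (a *: G) = a *: lpw_mul F G.
Proof. by apply/val_inj/funext => x /=; exact: mulrCA. Qed.

Lemma ler_lpw_mul F G : `|lpw_mul F G| <= `|F| * `|G|.
Proof.
rewrite -[leRHS](rmorphM (real_complex R) (lpnorm F) (lpnorm G)) lecR.
apply: lpnorm_le; last exact: lpsumM.
exact: mulr_ge0 (lpnorm_ge0 F) (lpnorm_ge0 G).
Qed.

HB.instance Definition _ := NormedModule_isNormedAlgebra.Build C L
  lpw_mulA lpw_mulDl lpw_mulDr lpw_mulZl lpw_mulZr ler_lpw_mul.

End lpw_normed_algebra.

(* Main.v *)
(* Let [phi] support the unit ball at [F]. On bounded functions [h] the functional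
   [mean h = phi (h F)] is positive and of mass one, and it is carried by the
   points of positive mass since [F] has small tails. If [mean h] were outside
   the (non-closed) convex hull of the values of [h] at these points, some real
   half-plane based at [mean h] would contain all these values, one of them in
   its interior (this is where the plane is used), and positivity would give
   [0 < Re (mean (c (h - mean h))) = 0].
   Conversely a finite mean of values of [f] with masses [mu] is attained at the
   unit vector [mu^(1/p) / w], normed by the functional with coefficients
   [w mu^(1 - 1/p)]. *)
From HB Require Import structures.
Require Import Defs.
From mathcomp Require Import all_boot all_order all_algebra.
From mathcomp Require Import complex ring lra.
From mathcomp Require Import all_classical all_reals.
From mathcomp Require Import ereal topology normedtype esum exp convex.

Set Implicit Arguments.
Unset Strict Implicit.
Unset Printing Implicit Defensive.

Import Order.TTheory GRing.Theory Num.Theory.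
Import numFieldNormedType.Exports.
Import ComplexField.Normc.
Local Open Scope classical_set_scope.
Local Open Scope ring_scope.

(** * Real parts and modulus in [R[i]] *)

Section complex_parts.
Variable R : realType.
Implicit Types z u : R[i].

Lemma ReD_complex z u : complex.Re (z + u) = complex.Re z + complex.Re u.
Proof. by case: z; case: u. Qed.

Lemma ReB_complex z u : complex.Re (z - u) = complex.Re z - complex.Re u.
Proof. by case: z; case: u. Qed.

Lemma ReM_complex z u : complex.Re (z * u) =
  complex.Re z * complex.Re u - complex.Im z * complex.Im u.
Proof. by case: z; case: u. Qed.

Lemma normc_ge0 z : 0 <= normc z.
Proof. by case: z => a b; exact: sqrtr_ge0. Qed.

Lemma sqr_normcE z : normc z ^+ 2 = complex.Re z ^+ 2 + complex.Im z ^+ 2.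
Proof. by case: z => a b /=; rewrite sqr_sqrtr// addr_ge0// sqr_ge0. Qed.

Lemma normr_normc z : `|z| = (normc z)%:C%C.
Proof. by []. Qed.

Lemma normc_real (a : R) : 0 <= a -> normc a%:C%C = a.
Proof. by move=> a0; rewrite /normc /= expr0n addr0 sqrtr_sqr ger0_norm. Qed.

Lemma ler_Re_normc z : `|complex.Re z| <= normc z.
Proof.
rewrite -[leRHS]ger0_norm ?normc_ge0// -ler_sqr ?nnegrE//.
by rewrite !real_normK ?num_real// sqr_normcE lerDl sqr_ge0.
Qed.

End complex_parts.

(** * Convex hulls and separation in the plane *)

Section convex_hull.
Variables (R : realType) (K : set R[i]).

Lemma sub_convex_hull : K `<=` convex_hull K.
Proof.
move=> z Kz; exists 1%N, (fun=> 1), (fun=> z); split => //.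
  by rewrite big_ord1.
by rewrite big_ord1 mul1r.
Qed.

Lemma convex_hull_conv (t : R) z u : 0 <= t <= 1 ->
  convex_hull K z -> convex_hull K u ->
  convex_hull K (t%:C%C * z + (1 - t)%:C%C * u).
Proof.
move=> /andP[t0 t1] [n [l [a [Ka l0 l1 ->]]]] [m [k [b [Kb k0 k1 ->]]]].
exists (n + m)%N, (fun i : 'I_(n + m) => match fintype.split i with
    | inl i => t * l i | inr j => (1 - t) * k j end),
  (fun i : 'I_(n + m) => match fintype.split i with inl i => a i | inr j => b j end); split.
- by move=> i; case: (fintype.split i).
- by move=> i; case: (fintype.split i) => j; rewrite mulr_ge0// subr_ge0.
- rewrite big_split_ord /=.
  under eq_bigr do rewrite (unsplitK (inl _)).
  under [X in _ + X]eq_bigr do rewrite (unsplitK (inr _)).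
  by rewrite -!mulr_sumr l1 k1 !mulr1 subrKC.
- rewrite big_split_ord /= !mulr_sumr; congr +%R; apply: eq_bigr => i _.
    by rewrite (unsplitK (inl _)) rmorphM mulrA.
  by rewrite (unsplitK (inr _)) rmorphM mulrA.
Qed.

(** Solving the relation for [v] gives the convex combination with weights [s / (s + t)] and
    [t / (s + t)]. The displacement form suits the separation argument, where everything is measured
    from one base point. *)
Lemma convex_hull_wavg (s t : R) z u v : 0 <= s -> 0 <= t -> 0 < s + t ->
  convex_hull K z -> convex_hull K u ->
  s%:C%C * (z - v) + t%:C%C * (u - v) = 0 -> convex_hull K v.
Proof.
move=> s0 t0 st0 Kz Ku e; have stN0 : s + t != 0 by rewrite gt_eqF.
suff -> : v = (s / (s + t))%:C%C * z + (1 - s / (s + t))%:C%C * u.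
  apply: convex_hull_conv => //; rewrite divr_ge0 ?addr_ge0//=.
  by rewrite ler_pdivrMr// mul1r lerDl.
have stC : (s + t)%:C%C != 0 :> R[i] by rewrite eq_complex /= eqxx andbT.
rewrite (_ : 1 - s / (s + t) = t / (s + t)); last by field.
apply: (mulfI stC); apply/eqP; rewrite -subr_eq0 -oppr_eq0.
rewrite mulrDr !mulrA -!rmorphM /= ![(s + t) * _]mulrC !divfK//.
by rewrite (rmorphD (real_complex R)) -[eqbRHS]e /=; apply/eqP; ring.
Qed.

End convex_hull.

Lemma convex_hullS (R : realType) (K L : set R[i]) :
  K `<=` L -> convex_hull K `<=` convex_hull L.
Proof.
move=> KL z [n [l [u [Ku l0 l1 ->]]]]; exists n, l, u; split => //.
by move=> i; exact/KL/Ku.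
Qed.

(* After a rotation some point of [K - z] is positive; a separating functional
   [Re - s Im] exists because the slopes [Re / Im] of the points in the lower
   half-plane stay below those of the points in the upper one. *)
Lemma convex_hull_separation (R : realType) (K : set R[i]) z k0 :
  K k0 -> ~ convex_hull K z ->
  exists c : R[i], (forall k, K k -> 0 <= complex.Re (c * (k - z))) /\
    exists2 k, K k & 0 < complex.Re (c * (k - z)).
Proof.
move=> Kk0 Kz.
have k0z : k0 - z != 0.
  rewrite subr_eq0; apply/eqP => e; apply: Kz; rewrite -e.
  exact: sub_convex_hull.
pose d := (k0 - z)^-1; pose r k := complex.Re (d * (k - z)).
pose m k := complex.Im (d * (k - z)).
have rm k : d * (k - z) = (r k +i* m k)%C by rewrite /r /m; case: (d * _).
have dI a : d * a = 0 -> a = 0.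
  by move/eqP; rewrite mulf_eq0 invr_eq0 (negbTE k0z) => /eqP.
have r0 : r k0 = 1 by rewrite /r /d mulVf.
have m0 : m k0 = 0 by rewrite /m /d mulVf.
(* In rotated coordinates [z] sits at 0 and [k0] at 1, so a hull point on the closed negative
   half-axis would put [z] on a segment ending at [k0]. *)
have notline a u : convex_hull K u -> d * (u - z) = (- a)%:C%C -> 0 <= a -> False.
  move=> Ku du a0; apply: Kz; apply: (@convex_hull_wavg _ K 1 a u k0) => //.
  - by rewrite ltr_wpDr.
  - exact: sub_convex_hull.
  - apply: dI; rewrite mulrDr !mulrA [d * 1%:C%C]mulrC [d * a%:C%C]mulrC -!mulrA.
    rewrite du /d mulVf// mulr1 mul1r.
    by rewrite -(rmorphD (real_complex R)) addNr.
have real_pos k : K k -> m k = 0 -> 0 < r k.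
  move=> Kk mk; rewrite ltNge; apply/negP => rk.
  apply: (@notline (- r k) k); last by rewrite oppr_ge0.
    exact: sub_convex_hull.
  by rewrite rm mk opprK.
have slopes a b : K a -> K b -> 0 < m a -> m b < 0 -> r b / m b <= r a / m a.
  move=> Ka Kb ma mb; rewrite ler_ndivrMr// -mulrAC ler_pdivrMr//.
  rewrite leNgt; apply/negP => lt.
  have sN0 : m a - m b != 0 by rewrite gt_eqF// subr_gt0 (lt_trans mb).
  have s0 : 0 < m a - m b by rewrite subr_gt0 (lt_trans mb).
  (* The weight at which the segment from [a] to [b] crosses the real axis. With the slopes in the
     wrong order the crossing is negative, against [notline]. *)
  pose t := - m b / (m a - m b).
  have t1 : 1 - t = m a / (m a - m b) by rewrite /t; field.
  pose u := t%:C%C * a + (1 - t)%:C%C * b.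
  apply: (@notline (- (t * r a + (1 - t) * r b)) u).
  - apply: convex_hull_conv; try exact: sub_convex_hull.
    rewrite -[t <= 1]subr_ge0 t1 !divr_ge0 ?(ltW s0) ?(ltW ma)//.
    by rewrite oppr_ge0 ltW.
  - have -> : d * (u - z) = t%:C%C * (d * (a - z)) + (1 - t)%:C%C * (d * (b - z)).
      by rewrite /u (rmorphB (real_complex R)) /=; ring.
    rewrite !rm opprK t1 /t; apply/eqP; rewrite eq_complex /=; apply/andP; split.
      by apply/eqP; ring.
    by apply/eqP; field.
  - rewrite t1 /t oppr_ge0 mulrAC [_ / _ * r b]mulrAC -mulrDl.
    by rewrite ler_pdivrMr// mul0r; lra.
suff [c [c0 [k Kk ck]]] : exists c : R[i],
    (forall k, K k -> 0 <= complex.Re (c * (r k +i* m k)%C)) /\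
    exists2 k, K k & 0 < complex.Re (c * (r k +i* m k)%C).
  exists (c * d); split=> [k' Kk'|]; first by rewrite -mulrA rm c0.
  by exists k => //; rewrite -mulrA rm.
(* If one open half-plane has no point, the other closed one separates, with [c] equal to ['i] or
   [- 'i]. If all points are real, they are positive and [c = 1] works. Only the mixed case needs
   the slopes. *)
have [[a [Ka ma]]|up] := pselect (exists a, K a /\ 0 < m a); last first.
  have up' k : K k -> m k <= 0.
    by move=> Kk; rewrite leNgt; apply/negP => mk; apply: up; exists k.
  have [[b [Kb mb]]|dn] := pselect (exists b, K b /\ m b < 0).
    exists ('i)%C; split=> [k Kk|]; last exists b => //; rewrite ReM_complex /=.
      by have := up' k Kk; lra.
    by lra.
  have dn' k : K k -> m k = 0.
    move=> Kk; apply/eqP; rewrite eq_le up'// leNgt; apply/negP => mk.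
    by apply: dn; exists k.
  exists 1; split=> [k Kk|]; last exists k0 => //; rewrite mul1r /= ?r0//.
  by rewrite ltW// real_pos// dn'.
have [[b [Kb mb]]|dn] := pselect (exists b, K b /\ m b < 0); last first.
  have dn' k : K k -> 0 <= m k.
    by move=> Kk; rewrite leNgt; apply/negP => mk; apply: dn; exists k.
  exists (- 'i)%C; split=> [k Kk|]; last exists a => //; rewrite ReM_complex /=.
    by have := dn' k Kk; lra.
  by lra.
pose S := [set r b / m b | b in [set b | K b /\ m b < 0]].
have Sub a' : K a' -> 0 < m a' -> ubound S (r a' / m a').
  by move=> Ka' ma' _ [b' [Kb' mb'] <-]; exact: slopes.
pose s := sup S; exists (1 +i* s)%C; split; last first.
  by exists k0 => //; rewrite ReM_complex /= r0 m0; lra.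
move=> k Kk; rewrite ReM_complex /= mul1r subr_ge0.
have [mk|mk|mk] := ltrgt0P (m k).
- rewrite -ler_pdivlMr//; apply: ge_sup; last exact: Sub.
  by exists (r b / m b), b.
- rewrite -ler_ndivrMr//; apply: ub_le_sup; last by exists k.
  by exists (r a / m a); exact: Sub.
- by rewrite mk mulr0 ltW// real_pos.
Qed.

(** * Multiplication of weighted sequences by bounded functions *)

Section bounded_multipliers.
Variables (R : realType) (X : choiceType) (p : R) (w : X -> R).
Variables (p1 : 1 <= p) (w1 : forall x, 1 <= w x).
Local Notation C := R[i].
Local Notation L := (lpw p1 w1).
Implicit Types (h k : X -> C) (F : L).

Definition bounded_mult h := exists M, forall i, normc (h i) <= M.

Lemma bounded_multP h : bounded_mult h ->
  exists2 M, 0 <= M & forall i, normc (h i) <= M.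
Proof.
case=> M hM; exists `|M| => // i.
by rewrite (le_trans (hM i)) ?ler_norm.
Qed.

Lemma bounded_mult_lin h k (a : C) : bounded_mult h -> bounded_mult k ->
  bounded_mult (fun i => h i + a * k i).
Proof.
move=> [M hM] [N kN]; exists (M + normc a * N) => i.
rewrite (le_trans (le_normcD _ _))// lerD// normcM.
by rewrite ler_wpM2l ?normc_ge0.
Qed.

Lemma bounded_multZ k (a : C) : bounded_mult k ->
  bounded_mult (fun i => a * k i).
Proof.
move=> [N kN]; exists (normc a * N) => i.
by rewrite normcM ler_wpM2l ?normc_ge0.
Qed.

Lemma bounded_mult_cst (a : C) : bounded_mult (fun=> a).
Proof. by exists (normc a). Qed.

Lemma bounded_mult_if (P : pred X) h : bounded_mult h ->
  bounded_mult (fun i => if P i then h i else 0).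
Proof.
move=> /bounded_multP[M M0 hM]; exists M => i.
by case: ifP => _; rewrite ?normc0.
Qed.

Lemma bounded_mult_lpw F : bounded_mult F.
Proof.
exists (lpnorm p w F) => i; apply: le_trans (lpnorm_ub F i).
by rewrite ler_peMr ?normc_ge0.
Qed.

Lemma lpsum_mult_le h M F : (forall i, normc (h i) <= M) -> 0 <= M ->
  (lpsum p w (fun i => h i * F i)%R <= ((M * lpnorm p w F) `^ p)%:E)%E.
Proof.
move=> hM M0; have w0 i : 0 <= w i by rewrite (le_trans ler01).
have n0 (g : X -> C) i : 0 <= normc (g i) * w i by rewrite mulr_ge0 ?normc_ge0.
rewrite powRM ?lpnorm_ge0// EFinM -lpsum_normE !lpsumE// -powsumZ//.
apply: powsum_le => // i; rewrite mulr_ge0 ?normc_ge0 ?w0//= normcM -mulrA.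
by rewrite ler_wpM2r ?mulr_ge0 ?normc_ge0.
Qed.

(** The default 0 makes this total in [h]; it never intervenes for bounded [h], by [bmulE]. *)
Definition bmul h F : L := insubd (0 : L) (fun i => h i * F i).

Lemma bmulE h F : bounded_mult h -> forall i, bmul h F i = h i * F i.
Proof.
move=> /bounded_multP[M M0 hM] i.
rewrite (_ : bmul h F i = val (bmul h F) i)// insubdK//.
exact: le_lt_trans (lpsum_mult_le F hM M0) (ltry _).
Qed.

Lemma lpnorm_bmul h M F : (forall i, normc (h i) <= M) -> 0 <= M ->
  lpnorm p w (bmul h F) <= M * lpnorm p w F.
Proof.
move=> hM M0; apply: lpnorm_le; first by rewrite mulr_ge0 ?lpnorm_ge0.
rewrite (_ : lpw_fun (bmul h F) = fun i => h i * F i); first exact: lpsum_mult_le.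
by apply/funext => i; rewrite bmulE//; exists M.
Qed.

Lemma bmul_lin h k (a : C) F : bounded_mult h -> bounded_mult k ->
  bmul (fun i => h i + a * k i) F = bmul h F + a *: bmul k F.
Proof.
move=> bh bk; apply/val_inj/funext => i.
rewrite [LHS]bmulE; last exact: bounded_mult_lin.
by rewrite [RHS]/(bmul h F i + a * bmul k F i) !bmulE// mulrDl mulrA.
Qed.

Lemma bmulZ k (a : C) F : bounded_mult k ->
  bmul (fun i => a * k i) F = a *: bmul k F.
Proof.
move=> bk; apply/val_inj/funext => i.
rewrite [LHS]bmulE; last exact: bounded_multZ.
by transitivity (a * bmul k F i) => //; rewrite bmulE// mulrA.
Qed.

Lemma bmul1 F : bmul (fun=> 1) F = F.
Proof.
apply/val_inj/funext => i; rewrite [LHS]bmulE ?mul1r//.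
exact: bounded_mult_cst.
Qed.

Lemma bmulA h k F : bounded_mult h -> bounded_mult k ->
  bounded_mult (fun i => h i * k i) ->
  bmul h (bmul k F) = bmul (fun i => h i * k i) F.
Proof.
move=> bh bk bhk; apply/val_inj/funext => i.
by rewrite [LHS]bmulE// [RHS]bmulE// bmulE// mulrA.
Qed.

Lemma lpnorm_tail F e : 0 < e -> exists s : seq X,
  lpnorm p w (bmul (fun i => if i \in s then 0 else 1) F) <= e.
Proof.
move=> e0; have p0 : 0 < p by exact: lt_le_trans p1.
pose a i := (normc (F i) `^ p * w i `^ p)%:E.
have a0 i : (0 <= a i)%E by rewrite lee_fin mulr_ge0 ?powR_ge0.
have Ffin : lpsum p w F \is a fin_num.
  by rewrite ge0_fin_numE ?lpw_fin//; apply: esum_ge0 => i _; exact: a0.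
have ep0 : 0 < e `^ p by rewrite powR_gt0.
have [_ [B [finB _] <-] ltB] := ub_ereal_sup_adherent ep0 Ffin.
have /finite_seqP[s Bs] := finB; exists s.
apply: lpnorm_le; first exact: ltW.
have FE : (lpsum p w F = \sum_(i \in B) a i + \esum_(i in ~` B) a i)%E.
  rewrite [LHS](esumID B)//; last by move=> i _; exact: a0.
  by rewrite !setTI esum_fset// => i _; exact: a0.
have Bfin : (\sum_(i \in B) a i)%E \is a fin_num.
  rewrite ge0_fin_numE ?fsume_ge0//; apply: le_lt_trans (lpw_fin F).
  by rewrite FE leeDl// esum_ge0.
have -> : lpsum p w (bmul (fun i => if i \in s then 0 else 1) F) =
    (\esum_(i in ~` B) a i)%E.
  rewrite esum_mkcond; apply: eq_esum => i _.
  rewrite bmulE; last first.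
    by exists 1 => j; case: ifP; rewrite ?normc0 ?normc1.
  rewrite in_setC (_ : (i \in B) = (i \in s)); last first.
    by rewrite Bs; apply/idP/idP; rewrite inE.
  case: ifP => /= _; first by rewrite mul0r normc0 powR0 ?gt_eqF// mul0r.
  by rewrite mul1r.
have lt : (lpsum p w F - (e `^ p)%:E < \sum_(i \in B) a i)%E := ltB.
rewrite ltW//; move: lt; rewrite FE lteBlDr// lteD2lE//.
Qed.

End bounded_multipliers.

(** * Positivity and support of the mean given by a norming functional *)

Section norming_functional.
Variables (R : realType) (X : choiceType) (p : R) (w : X -> R).
Variables (p1 : 1 <= p) (w1 : forall x, 1 <= w x).
Local Notation C := R[i].
Local Notation L := (lpw p1 w1).
Variables (F : L) (phi : {linear L -> C^o}).
Hypothesis phi_le : forall G : L, normc (phi G) <= lpnorm p w G.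
Hypothesis F1 : lpnorm p w F <= 1.
Hypothesis phiF : phi F = 1.
Implicit Types h k : X -> C.

Local Notation Re := (@complex.Re R).
Local Notation Im := (@complex.Im R).

Definition mean h : C := phi (bmul h F).

Lemma mean_lin h k a : bounded_mult h -> bounded_mult k ->
  mean (fun i => h i + a * k i) = mean h + a * mean k.
Proof. by move=> bh bk; rewrite /mean bmul_lin// linearD linearZ. Qed.

Lemma mean1 : mean (fun=> 1) = 1.
Proof. by rewrite /mean bmul1. Qed.

Lemma meanZ k a : bounded_mult k -> mean (fun i => a * k i) = a * mean k.
Proof. by move=> bk; rewrite /mean bmulZ// linearZ. Qed.

(* For small [t > 0], [|1 - t mean h|] is at most [sup |1 - t h|], which is
   [1 + O(t^2)] when [Re h >= 0]. *)
Lemma mean_ge0 h : bounded_mult h -> (forall i, 0 <= Re (h i)) ->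
  0 <= Re (mean h).
Proof.
move=> bh h0; have [M M0 hM] := bounded_multP bh.
have key t : 0 <= t -> (1 - t * Re (mean h)) ^+ 2 <= 1 + (t * M) ^+ 2.
  move=> t0; have b1 := @bounded_mult_cst R X 1.
  have := @mean_lin (fun=> 1) h (- t%:C%C) b1 bh; rewrite mean1 => e.
  have s0 : 0 <= Num.sqrt (1 + (t * M) ^+ 2) by exact: sqrtr_ge0.
  have q0 : 0 <= 1 + (t * M) ^+ 2 by rewrite addr_ge0 ?sqr_ge0.
  pose h' i := 1 + - t%:C%C * h i.
  have n1 : normc (mean h') <=
      Num.sqrt (1 + (t * M) ^+ 2).
    apply: le_trans (phi_le _) _; rewrite -[leRHS]mulr1.
    apply: le_trans (ler_wpM2l s0 F1); apply: lpnorm_bmul => // i.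
    rewrite -ler_sqr ?nnegrE ?normc_ge0// sqr_sqrtr// sqr_normcE.
    have hi : Re (h i) ^+ 2 + Im (h i) ^+ 2 <= M ^+ 2.
      by rewrite -sqr_normcE ler_sqr ?nnegrE ?normc_ge0.
    have := ler_wpM2l (sqr_ge0 t) hi.
    have := mulr_ge0 t0 (h0 i).
    by rewrite /h'; case: (h i) => a b /=; lra.
  have : normc (mean h') ^+ 2 <= 1 + (t * M) ^+ 2.
    by rewrite -[leRHS]sqr_sqrtr// ler_sqr ?nnegrE ?normc_ge0.
  rewrite e sqr_normcE.
  apply: le_trans; case: (mean h) => a b /=.
  rewrite -[leLHS]addr0 lerD ?sqr_ge0//.
  by rewrite oppr0 mul0r subr0 mulNr.
rewrite leNgt; apply/negP => r0; set r := Re (mean h) in key r0.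
have D0 : 0 < M ^+ 2 + 1 by rewrite ltr_wpDl ?sqr_ge0.
(* With this [t], writing [u] for its square and [N] for that of [M], [key] reads
   [(1 + u * (N + 1)) ^+ 2 <= 1 + u * N], absurd since [u > 0]. *)
pose t := - r / (M ^+ 2 + 1).
have t0 : 0 < t by rewrite divr_gt0 ?oppr_gt0.
have rE : r = - (t * (M ^+ 2 + 1)) by rewrite /t divfK ?opprK// gt_eqF.
have := key t (ltW t0); rewrite rE exprMn.
have : 0 < t ^+ 2 by rewrite exprn_gt0.
have : 0 <= M ^+ 2 by rewrite sqr_ge0.
move: (M ^+ 2) => N N0 t2.
move: (t ^+ 2) (expr2 t) t2 => u uE u0.
have : 0 <= N * u by exact: mulr_ge0 N0 (ltW u0).
have : 0 <= (u * (N + 1)) ^+ 2 by rewrite sqr_ge0.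
have -> : (1 - t * - (t * (N + 1))) ^+ 2 = (1 + u * (N + 1)) ^+ 2.
  by rewrite uE; ring.
lra.
Qed.

Definition unit_mult (j : X) : X -> C := fun i => if i == j then 1 else 0.

Lemma bounded_unit_mult j : bounded_mult (unit_mult j).
Proof. exact: (@bounded_mult_if _ _ (pred1 j) _ (@bounded_mult_cst R X 1)). Qed.

(** Positivity applied to ['i] and [- 'i] times [unit_mult j], both of real part zero, bounds the
    imaginary part from both sides by 0. *)
Lemma mean_unitE j : mean (unit_mult j) = (Re (mean (unit_mult j)))%:C%C.
Proof.
have bu := bounded_unit_mult j.
have nn a : Re a = 0 -> 0 <= Re (a * mean (unit_mult j)).
  move=> a0; rewrite -meanZ//; apply: mean_ge0.
    exact: bounded_multZ.
  by move=> i; rewrite /unit_mult; case: ifP; rewrite ?mulr1 ?mulr0 /= ?a0.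
have := nn 'i%C erefl; have := nn (- 'i)%C (oppr0 _).
rewrite !ReM_complex; case: (mean (unit_mult j)) => a b /= h1 h2.
apply/eqP; rewrite eq_complex /= eqxx /=; apply/eqP; lra.
Qed.

Lemma mean_unit_ge0 j : 0 <= Re (mean (unit_mult j)).
Proof.
apply: mean_ge0; first exact: bounded_unit_mult.
by move=> i; rewrite /unit_mult; case: ifP => _ /=.
Qed.

(** Points are cleared one at a time, each changing the mean by [h j] times the mass of [j]. The
    condition [h i != 0] lets [s] contain points of positive mass where [h] already vanishes. *)
Lemma mean_off_null h (s : seq X) : bounded_mult h ->
  (forall i, i \in s -> h i != 0 -> mean (unit_mult i) = 0) ->
  mean (fun i => if i \in s then 0 else h i) = mean h.
Proof.
elim: s h => [|j s IH] h bh hs; first by congr mean.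
pose g i := h i + (- h j) * unit_mult j i.
have bg : bounded_mult g by apply: bounded_mult_lin => //; exact: bounded_unit_mult.
have gE i : g i = if i == j then 0 else h i.
  rewrite /g /unit_mult; case: eqP => [->|_]; first by rewrite mulr1 subrr.
  by rewrite mulr0 addr0.
have -> : (fun i => if i \in j :: s then 0 else h i) =
    (fun i => if i \in s then 0 else g i).
  by apply/funext => i; rewrite inE gE; case: eqP => _ /=; case: ifP.
rewrite IH//; last first.
  move=> i si; rewrite gE; case: ifP => [|_ hi]; first by rewrite eqxx.
  by rewrite hs// inE si orbT.
rewrite mean_lin//; last exact: bounded_unit_mult.
have [->|hj] := eqVneq (h j) 0; first by rewrite oppr0 mul0r addr0.
by rewrite (hs j) ?inE ?eqxx// mulr0 addr0.
Qed.

(* Up to a small tail of [F], the part of [h] with negative real part lives on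
   finitely many points of mean zero. *)
Lemma mean_ge0_support h : bounded_mult h ->
  (forall i, 0 < Re (mean (unit_mult i)) -> 0 <= Re (h i)) ->
  0 <= Re (mean h).
Proof.
move=> bh h0; have [M M0 hM] := bounded_multP bh.
pose hn i := if Re (h i) < 0 then h i else 0.
have bn : bounded_mult hn.
  exact: (@bounded_mult_if _ _ (fun i => Re (h i) < 0)).
pose hp i := h i + (- 1) * hn i.
have bp : bounded_mult hp by exact: bounded_mult_lin.
have -> : mean h = mean hp + mean hn.
  by rewrite mean_lin// mulN1r subrK.
have hp0 : 0 <= Re (mean hp).
  apply: mean_ge0 => // i; rewrite /hp /hn mulN1r; case: ltP => //.
    by rewrite subrr.
  by rewrite subr0.
rewrite ReD_complex ler_wpDl// {hp bp hp0}.
suff small e : 0 < e -> - (M * e) <= Re (mean hn).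
  rewrite leNgt; apply/negP => r0; set r := Re _ in small r0.
  have D0 : 0 < M + 1 by rewrite ltr_wpDl.
  (* Then [r = - (2 * e * (M + 1))] lies below [- (M * e)], contradicting [small]. *)
  pose e := - r / (M + 1) / 2.
  have e0 : 0 < e by rewrite !divr_gt0 ?oppr_gt0.
  have rE : r = - (2 * e * (M + 1)).
    by rewrite /e; field; rewrite gt_eqF.
  by have := small e e0; rewrite rE; nra.
move=> e0; have [s sF] := lpnorm_tail F e0.
have null i : i \in s -> hn i != 0 -> mean (unit_mult i) = 0.
  rewrite /hn; case: ifP => [hi _ _|]; last by rewrite eqxx.
  rewrite mean_unitE; congr (_%:C%C); apply/eqP.
  rewrite eq_le mean_unit_ge0 andbT leNgt; apply/negP => /h0.
  by rewrite leNgt hi.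
rewrite -(mean_off_null bn null).
have b1 : bounded_mult (fun i : X => if i \in s then 0 else 1 : C).
  by exists 1 => j; case: ifP; rewrite ?normc0 ?normc1.
(* Factoring out the indicator of the complement of [s] makes [bmulA] expose the tail of [F], of
   norm at most [e], multiplied by a function bounded by [M]. *)
have sE : (fun i => if i \in s then 0 else hn i) =
    (fun i => hn i * (if i \in s then 0 else 1)).
  by apply/funext => i; case: ifP; rewrite ?mulr0 ?mulr1.
have hnM i : normc (hn i) <= M by rewrite /hn; case: ifP; rewrite ?normc0.
have bs : bounded_mult (fun i => hn i * (if i \in s then 0 else 1)).
  by exists M => i; case: ifP; rewrite ?mulr0 ?mulr1 ?normc0.
rewrite sE /mean -bmulA// -[leRHS]opprK lerN2.
apply: le_trans (ler_norm _) _; rewrite normrN.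
set G := bmul hn _.
apply: le_trans (ler_Re_normc (phi G : C)) _; apply: le_trans (phi_le G) _.
by apply: le_trans (lpnorm_bmul _ hnM M0) _; rewrite ler_wpM2l.
Qed.

(** Clearing the value at [j] keeps the mean nonnegative in real part, so that of [h] is at least
    [Re (h j)] times the mass of [j]. *)
Lemma mean_gt0_support h j : bounded_mult h ->
  (forall i, 0 < Re (mean (unit_mult i)) -> 0 <= Re (h i)) ->
  0 < Re (mean (unit_mult j)) -> 0 < Re (h j) -> 0 < Re (mean h).
Proof.
move=> bh h0 j0 hj; have bu := bounded_unit_mult j.
have : 0 <= Re (mean (fun i => h i + (- h j) * unit_mult j i)).
  apply: mean_ge0_support; first exact: bounded_mult_lin.
  move=> i li; rewrite /unit_mult; case: eqP => [->|_].
    by rewrite mulr1 subrr.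
  by rewrite mulr0 addr0 h0.
rewrite mean_lin// mean_unitE mulNr ReB_complex subr_ge0; apply: lt_le_trans.
by rewrite ReM_complex /= mulr0 subr0 mulr_gt0.
Qed.

(** Otherwise [mean_ge0_support] would apply vacuously to the constant -1, whose mean is -1. *)
Lemma mean_support_ex : exists j, 0 < Re (mean (unit_mult j)).
Proof.
apply: contrapT => /forallNP none.
have := @mean_ge0_support (fun=> (-1) * 1).
rewrite meanZ; last exact: bounded_mult_cst.
rewrite mean1 mulr1 /= oppr_ge0 leNgt ltr01.
move=> /(_ (@bounded_mult_cst _ _ _)) H.
by suff: false by []; apply: H => i /none.
Qed.

Lemma mean_convex_hull h : bounded_mult h -> convex_hull (range h) (mean h).
Proof.
move=> bh; pose S := [set i | 0 < Re (mean (unit_mult i))].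
(* Restricting to [S] ensures that the strict point supplied by separation has positive mass. *)
apply: (@convex_hullS _ (h @` S)); first exact: image_subset.
apply: contrapT => nhull; have [j Sj] := mean_support_ex.
have [c [c0 [_ [k Sk <-] ck]]] :=
  convex_hull_separation (imageP h Sj) nhull.
have b1 := @bounded_mult_cst R X 1.
pose g i := h i + (- mean h) * 1.
have bg : bounded_mult g by exact: bounded_mult_lin.
have g0 : mean g = 0 by rewrite mean_lin// mean1 mulr1 subrr.
have bcg : bounded_mult (fun i => c * g i) by exact: bounded_multZ.
suff : 0 < Re (mean (fun i => c * g i)) by rewrite meanZ// g0 mulr0 ltxx.
have gE i : g i = h i - mean h by rewrite /g mulr1.
apply: (mean_gt0_support bcg _ Sk); last by rewrite gE.
by move=> i Si; rewrite gE; apply: c0; exists i.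
Qed.

End norming_functional.

(** Young's inequality for [a] and 1; [p = 1] is treated apart because its conjugate exponent is
    infinite. *)
Lemma le_weighted_powR (R : realType) (p a : R) : 1 <= p -> 0 <= a ->
  a <= p^-1 * a `^ p + (1 - p^-1).
Proof.
rewrite le_eqVlt => /predU1P[<- a0|p1 a0].
  by rewrite invr1 mul1r powRr1// subrr addr0.
have p0 : 0 < p by exact: lt_trans p1.
have q0 : 0 < 1 - p^-1 by rewrite subr_gt0 invf_lt1.
have := @conjugate_powR R a 1 p (1 - p^-1)^-1 a0 ler01 p0.
rewrite invr_gt0 invrK subrKC => /(_ q0 erefl).
by rewrite mulr1 powR1 mul1r [_ / p]mulrC.
Qed.

(** * Dual norm and support functionals *)

Section unit_ball.
Variables (R : realType) (X : choiceType) (p : R) (w : X -> R).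
Variables (p1 : 1 <= p) (w1 : forall x, 1 <= w x).
Local Notation C := R[i].
Local Notation L := (lpw p1 w1).
Implicit Types (G : L) (phi : {linear L -> C^o}).

Lemma lpw_normE G : `|G| = (lpnorm p w G)%:C%C.
Proof. by []. Qed.

Lemma normc_le_lpnorm phi :
  (forall G, lpnorm p w G <= 1 -> normc (phi G) <= 1) ->
  forall G, normc (phi G) <= lpnorm p w G.
Proof.
move=> phi1 G; have [G0|GN0] := eqVneq (lpnorm p w G) 0.
  have -> : G = 0 by apply: lpnorm_eq0; rewrite G0.
  by rewrite linear0 normc0 lpnorm_ge0.
have r0 : 0 < lpnorm p w G by rewrite lt_neqAle eq_sym GN0 lpnorm_ge0.
set r := lpnorm p w G in GN0 r0 *.
have i0 : 0 <= r^-1 by rewrite invr_ge0 ltW.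
have : normc (phi ((r^-1)%:C%C *: G)) <= 1.
  apply: phi1; rewrite -lecR.
  have := lpnormZ (r^-1)%:C%C G; rewrite -/r normr_normc normc_real// => ->.
  by rewrite -rmorphM /= lecR mulVf.
by rewrite linearZ normcM normc_real// ler_pdivrMl// mulr1.
Qed.

Lemma normc_le_lpnorm_continuous phi :
  (forall G, normc (phi G) <= lpnorm p w G) -> continuous phi.
Proof.
move=> phi_le; apply/bounded_linear_continuous/linear_boundedP.
exists 1; split => // r r1 G.
apply: (@le_trans _ _ `|G|); last by rewrite ler_peMl// ltW.
by rewrite lpw_normE (normr_normc (phi G : C)) lecR.
Qed.

Lemma dual_norm_eq1 phi G : (forall G, normc (phi G) <= lpnorm p w G) ->
  lpnorm p w G <= 1 -> phi G = 1 -> dual_norm phi = 1.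
Proof.
move=> phi_le G1 phiG.
have Sub : ubound [set normc (phi a) | a in [set a : L | `|a| <= 1]] 1.
  move=> _ [a /= a1 <-]; apply: le_trans (phi_le a) _.
  by rewrite -lecR.
have S1 : [set normc (phi a) | a in [set a : L | `|a| <= 1]] 1.
  by exists G; rewrite /= ?phiG ?normc1// lpw_normE lecR.
apply/eqP; rewrite eq_le; apply/andP; split.
  by apply: ge_sup => //; exists 1.
by apply: ub_le_sup => //; exists 1.
Qed.

Lemma support_functional_le (F : L) phi : support_functionals F phi ->
  forall G, normc (phi G) <= lpnorm p w G.
Proof.
case=> _ phi1 _; apply: normc_le_lpnorm => G G1; rewrite -phi1.
(* The real [sup] defaults to 0 when there is no supremum, so dual norm 1 forces boundedness. *)
have sS : has_sup [set normc (phi a) | a in [set a : L | `|a| <= 1]].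
  apply: contrapT => /sup_out; rewrite -/(dual_norm phi) phi1 => /eqP.
  by rewrite oner_eq0.
apply: ub_le_sup; first by case: sS.
by exists G; rewrite //= lpw_normE lecR.
Qed.

End unit_ball.

(** * Functionals with finitely many coefficients *)

Section finite_functional.
Variables (R : realType) (X : choiceType) (p : R) (w : X -> R).
Variables (p1 : 1 <= p) (w1 : forall x, 1 <= w x).
Local Notation C := R[i].
Local Notation L := (lpw p1 w1).
Variables (s : seq X) (c : X -> R).

Definition finite_functional (G : L) : C^o := \sum_(i <- s) (c i)%:C%C * G i.

Lemma finite_functional_linear : linear finite_functional.
Proof.
move=> a G H; rewrite /finite_functional scaler_sumr -big_split.
apply: eq_bigr => i _; transitivity ((c i)%:C%C * (a * G i + H i)) => //.
by rewrite mulrDr mulrCA.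
Qed.

HB.instance Definition _ :=
  GRing.isLinear.Build C L C^o *:%R finite_functional finite_functional_linear.

End finite_functional.

(** * A unit vector and a norming functional realising a finite mean *)

Section norming_pair.
Variables (R : realType) (X : choiceType) (p : R) (w : X -> R).
Variables (p1 : 1 <= p) (w1 : forall x, 1 <= w x).
Local Notation C := R[i].
Local Notation L := (lpw p1 w1).
Variables (s : seq X) (mu : X -> R).
Hypothesis s_uniq : uniq s.
Hypothesis mu_gt0 : forall i, i \in s -> 0 < mu i.
Hypothesis mu1 : \sum_(i <- s) mu i = 1.

Let w0 i : 0 < w i. Proof. exact: lt_le_trans (w1 i). Qed.
Let p0 : 0 < p. Proof. exact: lt_le_trans p1. Qed.

Definition norming_fun i : C :=
  if i \in s then (mu i `^ p^-1 / w i)%:C%C else 0.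

Lemma lpsum_norming_fun : lpsum p w norming_fun = 1%E.
Proof.
have -> : lpsum p w norming_fun = (\esum_(i in [set` s]) (mu i)%:E)%E.
  rewrite [RHS]esum_mkcond; apply: eq_esum => i _; rewrite /norming_fun.
  rewrite mem_setE; case: ifPn => si; last first.
    by rewrite normc0 powR0 ?gt_eqF// mul0r.
  rewrite normc_real ?divr_ge0 ?powR_ge0 ?(ltW (w0 i))//.
  rewrite -powRM ?divr_ge0 ?powR_ge0 ?(ltW (w0 i))//.
  by rewrite divfK ?gt_eqF// -powRrM mulVf ?gt_eqF// powRr1// ltW// mu_gt0.
rewrite esum_fset//; last first.
  by move=> i; rewrite mem_setE => /mu_gt0/ltW; rewrite lee_fin.
by rewrite -fsbig_seq// sumEFin mu1.
Qed.

Lemma norming_funP : norming_fun \in lpw_pred p1 w1.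
Proof. by rewrite unfold_in lpsum_norming_fun ltry. Qed.

Definition norming_vec : L := Lpw norming_funP.

Lemma lpnorm_norming_vec : lpnorm p w norming_vec = 1.
Proof. by rewrite /lpnorm lpsum_norming_fun /= powR1. Qed.

(** The factor [mu i] is kept apart so that Young's inequality can be applied to the rest of each
    term. *)
Definition norming_coef i := mu i * w i * mu i `^ (- p^-1).

Local Notation phi := (finite_functional s norming_coef : L -> C^o).

Lemma norming_coefK i : i \in s ->
  (norming_coef i)%:C%C * norming_fun i = (mu i)%:C%C.
Proof.
move=> si; rewrite /norming_fun si -rmorphM /= /norming_coef; congr (_%:C%C).
have m0 := mu_gt0 si; have n0 : mu i `^ p^-1 != 0 by rewrite gt_eqF ?powR_gt0.
have wN0 : w i != 0 by rewrite gt_eqF.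
by rewrite powRN; field; rewrite n0 wN0.
Qed.

Lemma finite_functional_norming (G : L) : phi (amul G norming_vec) =
  \sum_(i <- s) (mu i)%:C%C * G i.
Proof.
rewrite /finite_functional !big_seq; apply: eq_bigr => i si.
by rewrite -norming_coefK// -mulrA [_ * G i]mulrC.
Qed.

Lemma finite_functional_norming1 : phi norming_vec = 1.
Proof.
rewrite /finite_functional -[RHS](rmorph1 (real_complex R)) -mu1 rmorph_sum.
by rewrite /= !big_seq; apply: eq_bigr => i si; rewrite norming_coefK.
Qed.

Lemma finite_functional_le (G : L) : lpnorm p w G <= 1 -> normc (phi G) <= 1.
Proof.
move=> G1; pose b i := normc (G i) * w i.
have b0 i : 0 <= b i by rewrite mulr_ge0 ?normc_ge0// ltW.
have sumb : \sum_(i <- s) b i `^ p <= 1.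
  rewrite -lee_fin -sumEFin; apply: (@le_trans _ _ (lpsum p w G)).
    rewrite fsbig_seq//; apply: ereal_sup_ubound; exists [set` s] => //.
    by apply: eq_fsbigr => i _; rewrite /b powRM ?normc_ge0// ltW.
  have -> : 1%E = (1 `^ p)%:E by rewrite powR1.
  by rewrite lpsum_normE lee_fin ge0_ler_powR ?nnegrE ?lpnorm_ge0 ?(ltW p0).
apply: (@le_trans _ _ (\sum_(i <- s) norming_coef i * normc (G i))).
  rewrite /finite_functional big_seq [leRHS]big_seq.
  apply: (big_ind2 (fun (z : C) r => normc z <= r)).
  - by rewrite normc0.
  - by move=> z r z' r' zr zr'; apply: le_trans (le_normcD _ _) (lerD zr zr').
  - move=> i si; rewrite normcM normc_real//.
    by rewrite !mulr_ge0 ?powR_ge0// ltW// mu_gt0.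
have term i : i \in s -> norming_coef i * normc (G i) <=
    p^-1 * b i `^ p + (1 - p^-1) * mu i.
  move=> si; have m0 := mu_gt0 si.
  (* Chosen so that [mu i * a]^ p = b i [^ p]. *)
  pose a := b i * mu i `^ (- p^-1).
  have a0 : 0 <= a by rewrite mulr_ge0 ?powR_ge0.
  rewrite (_ : _ * _ = mu i * a); last by rewrite /a /norming_coef /b; ring.
  have := ler_wpM2l (ltW m0) (le_weighted_powR p1 a0).
  rewrite /a powRM ?powR_ge0// -powRrM mulNr mulVf ?gt_eqF//.
  rewrite powR_inv1 ?(ltW m0)//; congr (_ <= _); field.
  by rewrite !gt_eqF.
rewrite big_seq; apply: le_trans (ler_sum _ term) _.
rewrite -big_seq big_split /= -!mulr_sumr mu1 mulr1 addrC -lerBrDl opprB.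
by rewrite addrCA subrr addr0 ler_piMr// invr_ge0 ltW.
Qed.

Lemma numrange_finite_mean (G : L) :
  numrange G (\sum_(i <- s) (mu i)%:C%C * G i).
Proof.
have phi_le := @normc_le_lpnorm _ _ _ _ p1 w1
  (finite_functional s norming_coef) finite_functional_le.
have phi1 := finite_functional_norming1.
have v1 := lpnorm_norming_vec.
exists norming_vec; first by rewrite /unit_sphere /= lpw_normE v1.
exists (finite_functional s norming_coef); last exact: finite_functional_norming.
split => //; first exact: normc_le_lpnorm_continuous.
by apply: (dual_norm_eq1 phi_le _ phi1); rewrite v1.
Qed.

End norming_pair.

(* The [t j] may repeat, so their weights are first merged into masses [mu i]. *)
Lemma numrange_mean (R : realType) (X : choiceType) (p : R) (w : X -> R)
    (p1 : 1 <= p) (w1 : forall x, 1 <= w x) (G : lpw p1 w1)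
    (n : nat) (t : 'I_n -> X) (l : 'I_n -> R) :
  (forall j, 0 <= l j) -> \sum_(j < n) l j = 1 ->
  numrange G (\sum_(j < n) (l j)%:C%C * G (t j)).
Proof.
move=> l0 l1; pose mu i := \sum_(j < n | t j == i) l j.
(* Null masses are discarded because the norming pair requires positive ones. *)
pose s := [seq i <- undup (codom t) | mu i != 0].
have mu0 i : 0 <= mu i by exact: sumr_ge0.
have mass (g : X -> R[i]) :
    \sum_(i <- s) (mu i)%:C%C * g i = \sum_(j < n) (l j)%:C%C * g (t j).
  rewrite big_filter big_mkcond /=.
  under eq_bigr => i _.
    rewrite (_ : (if _ then _ else _) =
      \sum_(j < n | t j == i) (l j)%:C%C * g i); first over.
    rewrite -mulr_suml -(rmorph_sum (real_complex R)) -/(mu i).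
    by case: eqP => //= ->; rewrite mul0r.
  rewrite (exchange_big_dep xpredT)//=; apply: eq_bigr => j _.
  rewrite (eq_bigl (pred1 (t j))) => [|i]; last exact: eq_sym.
  rewrite -big_filter filter_pred1_uniq ?undup_uniq//.
    by rewrite big_seq1.
  by rewrite mem_undup codom_f.
rewrite -mass; apply: numrange_finite_mean.
- by rewrite filter_uniq ?undup_uniq.
- by move=> i; rewrite mem_filter => /andP[mi _]; rewrite lt_neqAle eq_sym mi mu0.
(* Total mass one is the identity [mass] for the constant function 1. *)
- apply: (@complexI R); have := mass (fun=> 1).
  under eq_bigr do rewrite mulr1; under [RHS]eq_bigr do rewrite mulr1.
  by rewrite -!(rmorph_sum (real_complex R)) l1.
Qed.

(** * The two inclusions, and convexity *)

Theorem theorem2p4 (R : realType) (X : choiceType) (p : R) (w : X -> R)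
    (p1 : 1 <= p) (X0 : [set: X] !=set0) (w1 : forall x, 1 <= w x)
    (f : lpw p1 w1) :
  numrange f = convex_hull (range f) /\
  convex_set (numrange f : set (convex_lmodType (Rcomplex R))).
Proof.
have main : numrange f = convex_hull (range f).
  apply/seteqP; split => z.
    move=> [F F1 [phi sphi <-]].
    have nF : lpnorm p w F = 1 by apply: (@complexI R); rewrite -lpw_normE F1.
    have bf := @bounded_mult_lpw _ _ _ _ _ _ f.
    have F1' : lpnorm p w F <= 1 by rewrite nF.
    have [_ _ phiF] := sphi.
    have := mean_convex_hull (support_functional_le sphi) F1' phiF bf.
    congr (convex_hull _ _); rewrite /mean; congr (phi _).
    by apply/val_inj/funext => i; rewrite [LHS]bmulE.
  move=> [n [l [u [fu l0 l1 ->]]]].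
  have /choice[t tu] : forall j, exists i, f i = u j.
    by move=> j; have [i _ e] := fu j; exists i.
  under eq_bigr do rewrite -tu.
  exact: numrange_mean.
split=> // x y t; rewrite !inE main => fx fy.
(* Convexity is stated in the real vector space [Rcomplex R], so its scaling is matched with complex
   multiplication by reals. *)
have scaleE (a : R) (z : R[i]) : a%:C%C * z = a *: (z : Rcomplex R).
  by case: z => u v; apply/eqP; rewrite eq_complex /= !mul0r subr0 addr0 !eqxx.
have t01 : 0 <= t%:num <= 1 by apply/andP; split.
by have := convex_hull_conv t01 fx fy; rewrite !scaleE.
Qed.
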